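(* Let $G$ be a finite group of size $n \geq 2$ and $A$ a finite set of size $q \geq 2$. Let $T$ be a generating set of the monoid $\mathrm{CA}(G;A)$. Then there exists $\tau \in T$ whose minimal memory set is $S = G$.
   Context: Functions are applied on the right and composed left to right. $A^G$ is the set of all functions $x : G \to A$. A cellular automaton over $G$ and $A$ is a map $\tau : A^G \to A^G$ for which there are a finite subset $S \subseteq G$ (called a memory set of $\tau$) and a local function $\mu : A^S \to A$ with $(g)(x)\tau = ((R_g \circ x)|_S)\mu$ for all $x \in A^G$, $g \in G$, where $(h)R_g := hg$, so that $(h)(R_g\circ x) = (hg)x$. The minimal memory set of $\tau$ is the (unique) memory set of $\tau$ of smallest cardinality; it is contained in every memory set of $\tau$. $\mathrm{CA}(G;A)$ is the monoid of all cellular automata over $G$ and $A$ under composition. A subset $T$ of a monoid $M$ is a generating set of $M$ if the smallest submonoid of $M$ containing $T$ is $M$, i.e. every element of $M$ is a finite product of elements of $T$ (the empty product being the identity). *)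

(* Defs.v *)
From HB Require Import structures.
From mathcomp Require Import all_boot all_fingroup.

Set Implicit Arguments.
Unset Strict Implicit.
Unset Printing Implicit Defensive.

Local Open Scope group_scope.

Section CellularAutomata.

Variables (G : finGroupType) (A : finType).

Definition config := {ffun G -> A}.

(* The configuration [R_g \o x] of the right-action literature, where [R_g]
   is right translation [h |-> h * g]. *)
Definition translate (g : G) (x : config) : config := [ffun h => x (h * g)].

(* [{ffun {h | h \in S} -> A}] is the set [A^S] of patterns over [S]. *)
Definition restrict (S : {set G}) (x : config) : {ffun {h | h \in S} -> A} :=
  [ffun s => x (val s)].

Definition memory_set (tau : config -> config) (S : {set G}) : bool :=
  [exists mu : {ffun {ffun {h | h \in S} -> A} -> A},
     [forall x : config, [forall g : G,
        tau x g == mu (restrict S (translate g x))]]].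

Definition minimal_memory_set (tau : config -> config) (S : {set G}) : Prop :=
  memory_set tau S /\
  (forall S' : {set G}, memory_set tau S' -> #|S| <= #|S'|)%N.

Definition is_ca (tau : {ffun config -> config}) : bool :=
  [exists S : {set G}, memory_set tau S].

Record ca := CA { ca_fun :> {ffun config -> config}; ca_funP : is_ca ca_fun }.

HB.instance Definition _ := [isSub for ca_fun].
HB.instance Definition _ := [Finite of ca by <:].

Lemma is_ca_id : is_ca [ffun x => x].
Proof.
apply/existsP; exists [set 1]; apply/existsP.
exists [ffun p : {ffun {h : G | h \in [set 1]} -> A} =>
          p (exist (fun h => h \in [set 1]) 1 (set11 1))].
apply/forallP=> x; apply/forallP=> g; apply/eqP.
by rewrite !ffunE /= mul1g.
Qed.

Definition ca_id : ca := CA is_ca_id.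

Lemma ca_translate (tau : ca) (g : G) (x : config) :
  tau (translate g x) = translate g (tau x).
Proof.
case: tau => tau /=; case/existsP=> S /existsP[mu /forallP tauP].
apply/ffunP=> h; rewrite [in RHS]ffunE.
rewrite (eqP (forallP (tauP _) _)) (eqP (forallP (tauP _) _)).
by congr (mu _); apply/ffunP=> s; rewrite !ffunE mulgA.
Qed.

Lemma is_ca_comp (tau sigma : ca) : is_ca [ffun x => sigma (tau x)].
Proof.
apply/existsP; exists [set: G]; apply/existsP.
exists [ffun p : {ffun {h : G | h \in [set: G]} -> A} =>
          sigma (tau [ffun h => p (exist (fun h => h \in [set: G]) h
                                         (in_setT h))]) 1].
apply/forallP=> x; apply/forallP=> g; apply/eqP.
rewrite !ffunE; have -> : [ffun h => restrict [set: G] (translate g x)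
    (exist (fun h => h \in [set: G]) h (in_setT h))] = translate g x.
  by apply/ffunP=> h; rewrite !ffunE.
by rewrite !ca_translate ffunE mul1g.
Qed.

(* Maps act on the right: [tau * sigma] applies [tau] first, then [sigma]. *)
Definition ca_comp (tau sigma : ca) : ca := CA (is_ca_comp tau sigma).

Fact ca_compA : associative ca_comp.
Proof. by move=> a b c; apply/val_inj/ffunP=> x /=; rewrite !ffunE. Qed.

Fact ca_comp1l : left_id ca_id ca_comp.
Proof. by move=> a; apply/val_inj/ffunP=> x /=; rewrite !ffunE. Qed.

Fact ca_comp1r : right_id ca_id ca_comp.
Proof. by move=> a; apply/val_inj/ffunP=> x /=; rewrite !ffunE. Qed.

HB.instance Definition _ :=
  isMonoid.Build ca ca_compA ca_comp1l ca_comp1r.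

End CellularAutomata.

Definition generating_set (M : monoidType) (T : {pred M}) : Prop :=
  forall x : M, exists2 s : seq M, {subset s <= T} & x = \prod_(y <- s) y.

(* Main.v *)
Require Import Defs.
From mathcomp Require Import all_boot all_fingroup.

(** Sending one constant configuration to another and fixing everything else
    is a cellular automaton whose image misses exactly one configuration, so
    every generating set contains some [tau] with the same defect: [tau] misses
    one configuration [c] and collapses one pair onto some [d <> c].  Pick [g]
    with [d g <> c g].  Then [tau] is injective on the [x] with
    [tau x g = c g] and maps them onto the [z <> c] with [z g = c g].  The
    number of such [z] is [-1] modulo [#|A|], because the condition
    [z g = c g] ignores any other coordinate of [z].  If a memory set of [tau]
    omitted some [h], the condition [tau x g = c g] would ignore [x (h * g)],
    and the number of such [x] would be [0] modulo [#|A|]. *)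

Set Implicit Arguments.
Unset Strict Implicit.
Unset Printing Implicit Defensive.

Local Open Scope group_scope.

Section Counting.

Variables (I A : finType).

Definition update (x : {ffun I -> A}) (k : I) (a : A) : {ffun I -> A} :=
  [ffun i => if i == k then a else x i].

(** [P] splits into classes of functions that agree off [k], each class of size [#|A|]. *)
Lemma dvdn_card_update_closed (k : I) (P : {set {ffun I -> A}}) :
  (forall x a, x \in P -> update x k a \in P) -> #|A| %| #|P|.
Proof.
move=> Pk; have [-> | [x0 _]] := set_0Vmem P; first by rewrite cards0 dvdn0.
(* One representative per class, normalised to the value of [x0] at [k]. *)
pose P0 := [set x in P | x k == x0 k].
suff -> : P = [set update u.1 k u.2 | u in setX P0 [set: A]].
  rewrite card_in_imset ?cardsX ?cardsT ?dvdn_mull // => -[x a] [y b].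
  rewrite !inE /= !andbT => /andP[_ /eqP xk] /andP[_ /eqP yk] /ffunP exy.
  congr pair; last by have := exy k; rewrite !ffunE eqxx.
  apply/ffunP=> i; have := exy i; rewrite !ffunE.
  by case: (i =P k) => [-> _ | //]; rewrite xk yk.
apply/setP=> x; apply/idP/imsetP=> [Px | [[y a]]]; last first.
  by rewrite !inE /= andbT => /andP[Py _] ->; apply: Pk.
exists (update x k (x0 k), x k) => /=.
  by rewrite !inE /= andbT Pk //= ffunE eqxx.
by apply/ffunP=> i; rewrite !ffunE; case: eqP => [->|].
Qed.

End Counting.

Section OneMissingPoint.

Variables (X : finType) (f : X -> X).
Hypothesis defect1 : #|[set f x | x : X]|.+1 = #|X|.

(** Dropping one point [y0] of a colliding pair keeps the image; domain and image then have equal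
    size, which forces injectivity. *)
Lemma defect1_structure :
  exists c, exists2 y0, f y0 != c &
    {in [set~ y0] &, injective f} /\ f @: [set~ y0] = [set~ c].
Proof.
have /injectivePn[y0 [y1 y01 fy01]] : ~~ injectiveb f.
  apply/negP=> /injectiveP injf.
  by move: defect1; rewrite card_imset // => /eqP; rewrite gtn_eqF.
have im_y0 : f @: [set~ y0] = [set f x | x : X].
  apply/eqP; rewrite eqEsubset imsetS ?subset_predT //=.
  apply/subsetP=> _ /imsetP[x _ ->].
  have [-> | xy0] := eqVneq x y0; last by rewrite imset_f // !inE.
  by rewrite fy01 imset_f // !inE eq_sym.
have /eqP/cards1P[c defc] : #|~: [set f x | x : X]| = 1%N.
  by rewrite cardsCs setCK -defect1 subSnn.
have im_c : [set f x | x : X] = [set~ c] by rewrite -defc setCK.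
exists c; exists y0.
  by have := imset_f f (erefl : y0 \in X); rewrite im_c !inE.
split; last by rewrite im_y0.
by apply/imset_injP; rewrite im_y0 cardsC1 -defect1.
Qed.

End OneMissingPoint.

(** If [f] is a bijection, [g] has the image of the composite. Otherwise [f] misses a point, and its
    image is at least as large as that of the composite. *)
Lemma defect1_comp (X : finType) (f g : X -> X) :
  #|[set g (f x) | x : X]|.+1 = #|X| ->
  #|[set f x | x : X]|.+1 = #|X| \/ #|[set g x | x : X]|.+1 = #|X|.
Proof.
rewrite (imset_comp g f) => defect1.
have [injf | /injectiveP ninjf] := injectiveP f.
  have im_f : [set f x | x : X] = [set: X].
    by apply/eqP; rewrite eqEcard subsetT cardsT card_imset /=.
  right; rewrite -defect1 im_f; congr _.+1; apply: eq_card => z.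
  by apply/imsetP/imsetP=> -[x _ ->]; exists x.
left; apply/eqP; rewrite eqn_leq -{2}defect1 ltnS leq_imset_card andbT.
rewrite ltn_neqAle leq_imset_card andbT.
apply: contraNneq ninjf => /eqP/imset_injP injf.
by apply/injectiveP=> u v; apply: injf.
Qed.

Section MemorySets.

Variables (G : finGroupType) (A : finType).

(** A pattern over all of [G] is a whole configuration, so evaluating [tau] at [1] serves as local
    function. *)
Lemma memory_setT (tau : config G A -> config G A) :
  (forall g x, tau (translate g x) = translate g (tau x)) ->
  memory_set tau [set: G].
Proof.
move=> tauE; apply/existsP.
exists [ffun p : {ffun {h : G | h \in [set: G]} -> A} =>
          tau [ffun h => p (exist (fun h => h \in [set: G]) h (in_setT h))] 1].
apply/forallP=> x; apply/forallP=> g; apply/eqP; rewrite ffunE.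
rewrite (_ : [ffun h => _] = translate g x); first by rewrite tauE ffunE mul1g.
by apply/ffunP=> h; rewrite !ffunE.
Qed.

(** The value at [g] depends only on the cells [k * g] with [k] in [S]. *)
Lemma memory_set_update (tau : config G A -> config G A) (S : {set G})
    (x : config G A) (g h : G) (a : A) :
  memory_set tau S -> h \notin S -> tau (update x (h * g) a) g = tau x g.
Proof.
case/existsP=> mu /forallP tauP Sh.
rewrite !(eqP (forallP (tauP _) _)); congr (mu _); apply/ffunP=> -[k Sk].
rewrite !ffunE /= (inj_eq (mulIg g)).
by case: eqP Sk Sh => // -> ->.
Qed.

Lemma defect1_memory_set (tau : config G A -> config G A) (S : {set G}) :
  1 < #|G| -> 1 < #|A| ->
  #|[set tau x | x : config G A]|.+1 = #|{: config G A}| ->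
  memory_set tau S -> S = [set: G].
Proof.
move=> G_gt1 A_gt1 /defect1_structure[c [y0 tau_y0 [injtau im_tau]]] memS.
apply/eqP; rewrite eqEsubset subsetT; apply/subsetP=> h _.
apply/negPn/negP=> Sh.
(* This choice of [g] keeps [y0] out of [P], so [tau] is injective on [P]. *)
have /existsP[g neq_g] : [exists g, tau y0 g != c g].
  apply: contraR tau_y0 => /existsPn eq_c.
  by apply/eqP/ffunP=> g; apply/eqP/negPn/eq_c.
have [k gk] : exists k, g != k.
  have : 0 < #|[set~ g]| by rewrite cardsC1 -subn1 subn_gt0.
  by case/card_gt0P=> k; rewrite !inE eq_sym; exists k.
pose Z := [set z : config G A | z g == c g].
pose P := [set x : config G A | tau x g == c g].
have dvZ : #|A| %| #|Z|.
  apply: (@dvdn_card_update_closed _ _ k) => z a.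
  by rewrite !inE ffunE (negPf gk).
have dvP : #|A| %| #|P|.
  apply: (@dvdn_card_update_closed _ _ (h * g)) => x a.
  by rewrite !inE (memory_set_update _ _ _ memS Sh).
have sP : P \subset [set~ y0].
  by apply/subsetP=> x; rewrite !inE; apply: contraTneq => ->.
have imP : tau @: P = Z :\ c.
  apply/setP=> z; apply/imsetP/idP=> [[x Px ->] | ].
    have := imset_f tau (subsetP sP x Px); rewrite im_tau !inE => -> /=.
    by rewrite inE in Px.
  rewrite !inE => /andP[zc zg].
  have : z \in tau @: [set~ y0] by rewrite im_tau !inE.
  by case/imsetP=> x _ def_z; exists x; rewrite // inE -def_z.
have cardZ : #|Z| = #|P|.+1.
  rewrite (cardsD1 c) inE eqxx -imP card_in_imset //.
  by move=> x y /(subsetP sP) Px /(subsetP sP); apply: injtau.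
(* [#|A|] divides both [#|P|] and [#|P| + 1], hence [1]. *)
move: dvZ; rewrite cardZ -addn1 dvdn_addr // dvdn1 => /eqP A1.
by rewrite A1 in A_gt1.
Qed.

Definition collapse (a b : A) : {ffun config G A -> config G A} :=
  [ffun x => if x == [ffun => a] then [ffun => b] else x].

(** Translations are injective and fix constant configurations. *)
Lemma collapse_translate (a b : A) (g : G) (x : config G A) :
  collapse a b (translate g x) = translate g (collapse a b x).
Proof.
have trK : cancel (@translate G A g) (translate g^-1).
  by move=> y; apply/ffunP=> h; rewrite !ffunE mulgKV.
have trC d : translate g [ffun => d] = [ffun => d] :> config G A.
  by apply/ffunP=> h; rewrite !ffunE.
rewrite !ffunE -{1}(trC a) (inj_eq (can_inj trK)).
by case: ifP; rewrite ?trC.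
Qed.

Lemma is_ca_collapse (a b : A) : is_ca (collapse a b).
Proof.
by apply/existsP; exists [set: G]; apply/memory_setT/collapse_translate.
Qed.

Lemma card_collapse (a b : A) :
  a != b ->
  #|[set collapse a b x | x : config G A]|.+1 = #|{: config G A}|.
Proof.
move=> ab; have cab : [ffun => a] != [ffun => b] :> config G A.
  by apply: contraNneq ab => /ffunP/(_ 1); rewrite !ffunE => ->.
rewrite (_ : [set _ | x : _] = [set~ [ffun => a]]).
  by rewrite cardsC1 prednK //; apply/card_gt0P; exists [ffun => a].
apply/setP=> z; rewrite !inE; apply/imsetP/idP=> [[x _ ->] | za].
  by rewrite ffunE; case: ifP => [_|/negbT //]; rewrite eq_sym.
by exists z; rewrite // ffunE (negPf za).
Qed.

(** Induction on the word: the defect passes to its head or its tail, and the empty product misses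
    nothing. *)
Lemma defect1_factor (s : seq (ca G A)) :
  #|[set (\prod_(y <- s) y : ca G A) x | x : config G A]|.+1
    = #|{: config G A}| ->
  exists2 y : ca G A,
    y \in s & #|[set y x | x : config G A]|.+1 = #|{: config G A}|.
Proof.
elim: s => [|y s IHs].
  rewrite big_nil card_imset; last by move=> u v; rewrite !ffunE.
  by move/eqP; rewrite gtn_eqF.
rewrite big_cons => defect1.
have [|defect_y|/IHs[z sz defect_z]] := @defect1_comp _ y (\prod_(z <- s) z).
- rewrite -[RHS]defect1; congr _.+1; apply: eq_card => z.
  by apply/imsetP/imsetP=> -[x _ ->]; exists x; rewrite ?ffunE.
- by exists y; first exact: mem_head.
by exists z; rewrite // inE sz orbT.
Qed.

End MemorySets.

Theorem theorem3 (G : finGroupType) (A : finType) (T : {set ca G A}) :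
  (2 <= #|G|)%N -> (2 <= #|A|)%N ->
  generating_set (M := ca G A) (mem T) ->
  exists2 tau : ca G A, tau \in T & minimal_memory_set tau [set: G].
Proof.
move=> G_gt1 A_gt1 genT.
have /card_gt1P[a [b [_ _ ab]]] := A_gt1.
have [s sT def_s] := genT (CA (is_ca_collapse G a b)).
have [|tau s_tau defect1] := @defect1_factor G A s.
  by rewrite -def_s card_collapse.
exists tau; first exact: sT.
split; first by apply: memory_setT => g x; rewrite ca_translate.
by move=> S /(defect1_memory_set G_gt1 A_gt1 defect1) ->.
Qed.
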